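(* For $v_\star(x)=2\cos x$, the convex action profile $f(c|v_\star;0)$ is the Vershik–Kerov–Logan–Shepp profile: $$f(c|v_\star;0)=\begin{cases}\frac{2}{\pi}\Big(c\arcsin\big(\tfrac c2\big)+\sqrt{4-c^2}\Big),&|c|\le2,\\ |c|,&|c|\ge2.\end{cases}$$
   Context: For a bounded real $2\pi$-periodic function $v$, the convex action profile $f(c|v;0)$ is the convex function of $c\in\mathbb{R}$ characterized by $\frac12(1+f'(c|v;0))=\frac{1}{2\pi}\mathrm{Leb}\{x\in[0,2\pi]:v(x)\le c\}$ (for a.e. $c$) and $f(c|v;0)-|c-a|\to0$ as $c\to\pm\infty$, where $a=\int_0^{2\pi}v(x)\frac{dx}{2\pi}$. *)

(* Defs.v *)
From HB Require Import structures.
From mathcomp Require Import all_boot all_order all_algebra.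
From mathcomp Require Import all_classical all_reals all_analysis.

Set Implicit Arguments.
Unset Strict Implicit.
Unset Printing Implicit Defensive.

Import Order.TTheory GRing.Theory Num.Theory.
Import numFieldNormedType.Exports.
Local Open Scope classical_set_scope.
Local Open Scope ring_scope.

Definition mean_value (R : realType) (v : R -> R) : R :=
  \int[@lebesgue_measure R]_(x in `[0, 2 * pi]) (v x / (2 * pi)).

(* [f] is the convex action profile f(.|v;0) of a bounded measurable 2 pi-periodic
   [v].  The conditions below make sense for every [v], so those assumptions on
   [v] are not repeated here.  As a convex function is only differentiable
   almost everywhere, [derivable] is what makes [derive1] meaningful;
   the measured set lies in [0, 2 pi], so [fine] only casts a finite value. *)
Definition is_convex_action_profile (R : realType) (v f : R -> R) : Prop :=
  [/\ @convex_function R R^o setT f,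
      {ae @lebesgue_measure R, forall c : R,
         derivable f c 1 /\
         2^-1 * (1 + derive1 f c) =
           (2 * pi)^-1 *
             fine (@lebesgue_measure R
                     (`[0, 2 * pi] `&` [set x | v x <= c]))},
      f c - `|c - mean_value v| @[c --> +oo] --> (0 : R) &
      f c - `|c - mean_value v| @[c --> -oo] --> (0 : R)].

(* Main.v *)
Require Import Defs.
From HB Require Import structures.
From mathcomp Require Import all_boot all_order all_algebra.
From mathcomp Require Import all_classical all_reals all_analysis.
From mathcomp Require Import ring lra.
Set Implicit Arguments.
Unset Strict Implicit.
Unset Printing Implicit Defensive.
Import Order.TTheory GRing.Theory Num.Theory.
Import numFieldNormedType.Exports.
Local Open Scope classical_set_scope.
Local Open Scope ring_scope.

(* If c = 2 sin t with |t| <= pi / 2, the profile is F(c) = (2 / pi) (c t + 2 cos t)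
   and k(c) = 2 t / pi is a subgradient of F at c: this reduces to the fact that
   the concave function cos lies below its tangents on [-pi / 2, pi / 2].  As k
   is continuous, F is convex and F' = k everywhere, while the sublevel set
   {2 cos <= c} of [0, 2 pi] has measure pi + 2 t, so F satisfies the defining
   equation.  For uniqueness, a convex f with f' = k almost everywhere has slope k at
   a dense set of points, hence k is a subgradient field of f by continuity, so
   f' = k everywhere; then f - F is constant, and it vanishes at infinity. *)

(** * Subgradients, derivatives and convexity on the real line *)

Definition subgradient_field (R : realType) (f k : R -> R) :=
  forall x y, k x * (y - x) <= f y - f x.

(** The subgradient inequalities at [x] and at [x + h] trap the difference quotient between [k x]
    and [k (h + x)], and continuity of [k] closes the gap. *)
Lemma is_derive_subgradient (R : realType) (f k : R -> R) (x : R) :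
  subgradient_field f k -> continuous k -> is_derive x 1 f (k x).
Proof.
move=> fk kc.
have q : h^-1 *: ((f \o shift x) (h *: (1 : R)) - f x) @[h --> 0^'] --> k x.
  apply/cvgrPdist_lt => e e0.
  have /cvgrPdist_lt/(_ e e0) := kc x.
  move=> /nbhs_ballP[r /= r0 Hr]; near=> h.
  have h0 : h != 0 by near: h; exact: nbhs_dnbhs_neq.
  have He : `|k x - k (h + x)| < e.
    apply: Hr; rewrite /ball /= opprD addrCA subrr addr0 normrN.
    by near: h; exact: dnbhs0_lt.
  apply: le_lt_trans He.
  rewrite /= [h *: 1]mulr1 /GRing.scale /=.
  have f1 := fk x (h + x); have f2 := fk (h + x) x.
  rewrite addrK in f1; have {}f2 : f (h + x) - f x <= k (h + x) * h by lra.
  set F := f (h + x) - f x in f1 f2 *.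
  have hn : `|h| != 0 by rewrite normr_eq0.
  rewrite -(ler_pM2r (x := `|h|)) ?normr_gt0// -!normrM.
  rewrite mulrBl mulrAC mulVf// mul1r.
  rewrite ler0_norm ?subr_le0// ler0_norm ?mulrBl ?subr_le0; last lra.
  lra.
by apply: DeriveDef; [exact: cvgP q | exact: cvg_lim q].
Unshelve. all: by end_near. Qed.

Lemma convex_functionP (R : realType) (f : R -> R) :
  @convex_function R R^o setT f <->
  forall t x y, 0 <= t -> t <= 1 ->
    f (t * x + (1 - t) * y) <= t * f x + (1 - t) * f y.
Proof.
split=> [fc t x y t0 t1|fc t x y _ _].
  by have := fc (Itv01 t0 t1) x y (mem_setT _) (mem_setT _); rewrite !convRE.
by rewrite !convRE; apply: fc.
Qed.

(** Averaging the inequalities based at [z] with weights [t] and [1 - t] cancels the linear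
    terms. *)
Lemma subgradient_convex (R : realType) (f k : R -> R) :
  subgradient_field f k -> @convex_function R R^o setT f.
Proof.
move=> fk; apply/convex_functionP => t x y t0 t1.
set z := t * x + _.
have fx := fk z x; have fy := fk z y.
have Hx := ler_wpM2l t0 fx.
have t1' : 0 <= 1 - t by lra.
have Hy := ler_wpM2l t1' fy.
have : t * (k z * (x - z)) + (1 - t) * (k z * (y - z)) = 0.
  by rewrite /z; ring.
lra.
Qed.

Lemma convex_derivable_subgradient (R : realType) (f : R -> R) (d y : R) :
  @convex_function R R^o setT f -> derivable f d 1 ->
  derive1 f d * (y - d) <= f y - f d.
Proof.
move=> /convex_functionP fc /derivable1_diffP df.
(* Differentiating in the direction [y - d] makes a step [t] in []0, 1[] land on the convex
   combination of [y] and [d], where convexity bounds the quotient. *)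
have dfy : is_derive d (y - d) f (derive1 f d * (y - d)).
  apply: DeriveDef; first exact: diff_derivable.
  rewrite deriveE// derive1E deriveE//.
  by rewrite -[in LHS](mulr1 (y - d)) linearZ /= mulrC.
have := @ex_derive _ _ _ _ _ _ _ dfy; rewrite /derivable.
have := @derive_val _ _ _ _ _ _ _ dfy; rewrite /derive => <-.
move=> cv; rewrite cvg_at_rightE//.
have {}cv := cvg_dnbhs_at_right cv.
apply: limr_le; first exact: cvgP cv.
near=> t.
have t0 : 0 < t by [].
have t1 : t < 1 by near: t; exact: nbhs_right_lt.
rewrite /= /GRing.scale /= -(ler_pM2l t0) mulrA mulfV ?gt_eqF// mul1r.
have := fc t y d (ltW t0) (ltW t1).
have -> : t * (y - d) + d = t * y + (1 - t) * d by ring.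
lra.
Unshelve. all: by end_near. Qed.

(** A null set cannot contain an interval of positive length. *)
Lemma ae_dense (R : realType) (P : R -> Prop) (a b : R) :
  {ae @lebesgue_measure R, forall x, P x} -> a < b ->
  exists2 x, x \in `]a, b[ & P x.
Proof.
move=> [N [mN N0 PN]] ab; apply: contrapT => nex.
have abN : `]a, b[%classic `<=` N.
  by move=> x xab; apply: PN => Px; apply: nex; exists x.
have : (lebesgue_measure (`]a, b[%classic : set R) <= lebesgue_measure N)%E.
  by apply: le_measure => //; rewrite inE//; exact: measurable_itv.
rewrite N0 lebesgue_measure_itv /= lte_fin ab -EFinB lee_fin; lra.
Qed.

Lemma subgradient_dense (R : realType) (f k : R -> R) (D : R -> Prop) :
  @convex_function R R^o setT f -> continuous k ->
  (forall a b, a < b -> exists2 x, x \in `]a, b[ & D x) ->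
  (forall x y, D x -> k x * (y - x) <= f y - f x) ->
  subgradient_field f k.
Proof.
move=> /convex_functionP fc kc Dd fk x y; rewrite leNgt; apply/negP => xy.
have [e /= e0 He] : \forall z \near x, f y - f x < k z * (y - x).
  have : k z * (y - x) @[z --> x] --> k x * (y - x).
    by apply: cvgM; [exact: kc|exact: cvg_cst].
  by move/cvgr_gt; apply.
(* By convexity the slope of the chord from x to y is compared with that of the
   chord from d to x, which the subgradient at d controls. *)
have key d : D d -> `|x - d| < e -> (x - d) * (y - x) > 0 -> False.
  move=> Dd' xde pos; have := He d xde; rewrite ltNge => /negP; apply.
  have yd0 : y - d != 0.
    apply: contraTneq pos => yd; have -> : d = y by lra.
    by rewrite -leNgt -(opprB y x) mulNr oppr_le0 -expr2 sqr_ge0.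
  (* The weight of [y] when [x] is written as a combination of [y] and [d]. Since
     [(x - d) * (y - x)] equals [t * (1 - t) * (y - d) ^+ 2], its positivity forces [0 < t < 1]. *)
  pose t := (x - d) / (y - d).
  have xE : x = t * y + (1 - t) * d by rewrite /t; field.
  have yx : y - x = (1 - t) * (y - d) by rewrite xE; ring.
  have xd : x - d = t * (y - d) by rewrite xE; ring.
  have yd2 : 0 < (y - d) ^+ 2 by rewrite exprn_even_gt0.
  have tt : 0 < t * (1 - t).
    by rewrite -(pmulr_lgt0 _ yd2); move: pos; rewrite yx xd; lra.
  have t0 : 0 < t by nra.
  have t1 : t < 1 by nra.
  have := fc t y d (ltW t0) (ltW t1); rewrite -xE => h1.
  have h2 := fk d x Dd'; rewrite xd in h2.
  rewrite yx -(ler_pM2l t0); nra.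
(* The point [d] is taken on the side of [x] away from [y], so that [x] lies between them. *)
have [yx|yx|yx] := ltgtP y x; last by rewrite yx !subrr mulr0 ltxx in xy.
  have [|d dI Dd'] := Dd x (x + e); first by rewrite ltrDl.
  move: dI; rewrite in_itv /= => /andP[? ?].
  by apply: (key d) => //; [rewrite ltr0_norm; lra | nra].
have [|d dI Dd'] := Dd (x - e) x; first by rewrite ltrBlDr ltrDl.
move: dI; rewrite in_itv /= => /andP[? ?].
by apply: (key d) => //; [rewrite gtr0_norm; lra | nra].
Qed.

(** * The candidate profile and its slope *)

(* The clamping avoids the junk values of asin outside [-1, 1]. *)
Definition arc (R : realType) (c : R) : R :=
  asin (Num.max (-1) (Num.min 1 (c / 2))).

(** One formula for both cases of the profile: beyond 2 in absolute value the angle is frozen at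
    plus or minus [pi / 2], the cosine vanishes and [|c|] remains. *)
Definition vkls (R : realType) (c : R) : R :=
  2 / pi * (c * arc c + 2 * cos (arc c)).

Definition vkls_slope (R : realType) (c : R) : R := 2 / pi * arc c.

Lemma clamp_itv (R : realType) (x : R) :
  -1 <= Num.max (-1) (Num.min 1 x) <= 1.
Proof. by rewrite le_max lexx /= ge_max ge_min lexx /= andbT; lra. Qed.

Lemma arc_itv (R : realType) (c : R) : - (pi / 2) <= arc c <= pi / 2.
Proof. by rewrite asin_geNpi2 ?asin_lepi2 ?clamp_itv. Qed.

Lemma sin_arc (R : realType) (c : R) :
  sin (arc c) = Num.max (-1) (Num.min 1 (c / 2)).
Proof. by rewrite asinK// in_itv /= clamp_itv. Qed.

Lemma arc_mid (R : realType) (c : R) : `|c| <= 2 -> arc c = asin (c / 2).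
Proof.
rewrite ler_norml => /andP[c1 c2]; rewrite /arc min_r; last lra.
by rewrite max_r//; lra.
Qed.

Lemma arc_ge2 (R : realType) (c : R) : 2 <= c -> arc c = pi / 2.
Proof.
move=> c2; rewrite /arc min_l; last lra.
rewrite max_r; last lra.
by rewrite -[in LHS](sin_pihalf R) sinK// in_itv /=; have := pi_gt0 R; lra.
Qed.

Lemma arc_leN2 (R : realType) (c : R) : c <= -2 -> arc c = - (pi / 2).
Proof.
move=> c2; rewrite /arc min_r; last lra.
rewrite max_l; last lra.
rewrite -[in LHS](sin_pihalf R) -sinN sinK// in_itv /=.
by have := pi_gt0 R; lra.
Qed.

Lemma sin_le_pihalf (R : realType) (x y : R) :
  - (pi / 2) <= x -> y <= pi / 2 -> x <= y -> sin x <= sin y.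
Proof.
move=> xl yu xy; rewrite leNgt ltr_sin -?leNgt//.
  by rewrite in_itv /= yu (le_trans xl).
by rewrite in_itv /= xl (le_trans xy).
Qed.

(** The mean value theorem gives a slope [- sin x] with [x] between [s] and [t], and [sin] is
    monotone there. *)
Lemma cos_le_tangent (R : realType) (s t : R) :
  - (pi / 2) <= s <= pi / 2 -> - (pi / 2) <= t <= pi / 2 ->
  cos t <= cos s + (s - t) * sin s.
Proof.
move=> /andP[s1 s2] /andP[t1 t2].
have cosw a b : {within `[a, b], continuous (@cos R)}.
  exact/continuous_subspaceT/continuous_cos.
have [st|ts] := leP s t.
  have [x] := MVT_segment st (fun x _ => is_derive_cos x) (cosw _ _).
  rewrite in_itv /= => /andP[sx xt] E.
  have := sin_le_pihalf s1 (le_trans xt t2) sx.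
  nra.
have [x] := MVT_segment (ltW ts) (fun x _ => is_derive_cos x) (cosw _ _).
rewrite in_itv /= => /andP[tx xs] E.
have := sin_le_pihalf (le_trans t1 tx) s2 xs.
nra.
Qed.

(** The first factor vanishes for [y] in [[-2, 2]]. Beyond, it has the sign of [y], and so does the
    second, because [arc y] is then extremal. *)
Lemma arc_dominates (R : realType) (x y : R) :
  0 <= (y - 2 * sin (arc y)) * (arc y - arc x).
Proof.
have /andP[x1 x2] := arc_itv x.
have [y2|y2] := leP 2 y.
  rewrite sin_arc (arc_ge2 y2) min_l; last lra.
  by rewrite max_r; nra.
have [yN2|yN2] := leP y (-2).
  rewrite sin_arc (arc_leN2 yN2) min_r; last lra.
  by rewrite max_l; nra.
by rewrite sin_arc min_r ?max_r; lra.
Qed.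

Lemma vkls_subgradient (R : realType) :
  subgradient_field (@vkls R) (@vkls_slope R).
Proof.
move=> x y; rewrite -subr_ge0 /vkls /vkls_slope.
set u := 2 / pi.
(* The convexity gap splits into the excess of [y] over its clamped value and the gap between [cos]
   and its tangent at [arc y]. *)
have -> : u * (y * arc y + 2 * cos (arc y)) - u * (x * arc x + 2 * cos (arc x))
    - u * arc x * (y - x) =
  u * ((y - 2 * sin (arc y)) * (arc y - arc x) +
    2 * (cos (arc y) + (arc y - arc x) * sin (arc y) - cos (arc x))) by ring.
apply: mulr_ge0; first by rewrite /u divr_ge0// pi_ge0.
rewrite addr_ge0 ?arc_dominates// mulr_ge0// subr_ge0.
exact: cos_le_tangent (arc_itv _) (arc_itv _).
Qed.

(** As the inverse of [sin], [asin] is known to be continuous only within [[-1, 1]]; the clamp is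
    continuous and never leaves that interval. *)
Lemma arc_continuous (R : realType) : continuous (@arc R).
Proof.
have pi0 := pi_gt0 R.
have asinc : {within `[(-1 : R), 1], continuous (@asin R)}.
  have := @segment_can_le_continuous R (- (pi / 2)) (pi / 2) sin asin.
  rewrite sinN sin_pihalf; apply; first lra.
  - exact/continuous_subspaceT/continuous_sin.
  - by move=> x; exact: sinK.
move=> c; rewrite /continuous_at /arc.
move/subspace_continuousP : asinc => /(_ (Num.max (-1) (Num.min 1 (c / 2)))).
rewrite /= in_itv /= clamp_itv => /(_ isT) asinc.
have clampc : continuous (fun c : R => Num.max (-1) (Num.min 1 (c / 2))).
  have minc : continuous ((fun=> 1) \min (fun c : R => c / 2)).
    apply: min_fun_continuous; first exact: cst_continuous.
    exact: mulrr_continuous.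
  have maxc : continuous ((fun=> -1) \max ((fun=> 1) \min (fun c : R => c / 2))).
    by apply: max_fun_continuous minc; exact: cst_continuous.
  exact: maxc.
apply: cvg_comp asinc => A /= wA; near=> z.
have : `[(-1 : R), 1]%classic (Num.max (-1) (Num.min 1 (z / 2))) ->
    A (Num.max (-1) (Num.min 1 (z / 2))) by near: z; exact: clampc wA.
by apply; rewrite /= in_itv /=; exact: clamp_itv.
Unshelve. all: by end_near.
Qed.

Lemma vkls_slope_continuous (R : realType) : continuous (@vkls_slope R).
Proof. by move=> c; apply: cvgM; [exact: cvg_cst|exact: arc_continuous]. Qed.

Lemma vkls_mid (R : realType) (c : R) : `|c| <= 2 ->
  vkls c = 2 / pi * (c * asin (c / 2) + Num.sqrt (4 - c ^+ 2)).
Proof.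
move=> c2; rewrite /vkls arc_mid//; congr (_ * (_ + _)).
move: c2; rewrite ler_norml => /andP[c1 c2].
rewrite cos_asin; last by apply/andP; split; lra.
have -> : 4 - c ^+ 2 = 2 ^+ 2 * (1 - (c / 2) ^+ 2) by field.
by rewrite sqrtrM ?sqr_ge0// sqrtr_sqr ger0_norm.
Qed.

Lemma vkls_out (R : realType) (c : R) : 2 <= `|c| -> vkls c = `|c|.
Proof.
have pi0 : (pi : R) != 0 by rewrite gt_eqF ?pi_gt0.
rewrite ler_normr => /orP[c2|c2].
  rewrite /vkls arc_ge2// cos_pihalf ger0_norm; last lra.
  by move: (pi : R) pi0 => p p0; field.
rewrite /vkls arc_leN2 ?cosN ?cos_pihalf ?ler0_norm; [|lra..].
by move: (pi : R) pi0 => p p0; field.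
Qed.

(** * Mean value and sublevel sets of [2 * cos] *)

Lemma mean_value_2cos (R : realType) : mean_value (fun x : R => 2 * cos x) = 0.
Proof.
have pi0 := pi_gt0 R.
have D (x : R) : is_derive x 1 (fun x : R => sin x / pi) (2 * cos x / (2 * pi)).
  apply: is_derive_eq; rewrite /GRing.scale /=.
  by move: (pi : R) pi0 => p p0; field; rewrite gt_eqF.
have sc : continuous (fun x : R => sin x / pi).
  by move=> x; apply: cvgM; [exact: continuous_sin|exact: cvg_cst].
rewrite /mean_value /Rintegral (@continuous_FTC2 R _ (fun x => sin x / pi)).
- by rewrite mulr_natl sin2pi sin0 mul0r subee.
- by rewrite mulr_gt0.
- apply: continuous_subspaceT => x.
  apply: cvgM; last exact: cvg_cst.
  by apply: cvgM; [exact: cvg_cst|exact: continuous_cos].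
- split.
  + by move=> x _; exact: (@ex_derive _ _ _ _ _ _ _ (D x)).
  + exact/cvg_at_right_filter/sc.
  + exact/cvg_at_left_filter/sc.
- by move=> x _; rewrite derive1E; exact: (@derive_val _ _ _ _ _ _ _ (D x)).
Qed.

(** The left endpoint [a] has cosine [min 1 (c / 2)]. On [[0, pi]] the cosine decreases, so the
    condition reads [a <= x]; reflection about [pi] gives the other half. *)
Lemma sublevel_2cos (R : realType) (c : R) : -2 <= c ->
  `[0, 2 * pi] `&` [set x | 2 * cos x <= c] =
  `[pi / 2 - arc c, 2 * pi - (pi / 2 - arc c)]%classic.
Proof.
move=> cN2; have pi0 := pi_gt0 R.
set a := pi / 2 - arc c.
have [a0 api] : 0 <= a /\ a <= pi.
  by have /andP[] := arc_itv c; rewrite /a; lra.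
have cosa : cos a = Num.min 1 (c / 2).
  rewrite /a -cosN opprB cosBpihalf sin_arc max_r// le_min; lra.
have cos_le x : 0 <= x -> x <= pi -> (2 * cos x <= c) = (a <= x).
  move=> x0 xpi; rewrite (leNgt a) -ltr_cos ?in_itv/= ?x0 ?a0// -leNgt cosa.
  by rewrite le_min cos_le1 /= ler_pdivlMr// mulrC.
have cos_sym (x : R) : cos (2 * pi - x) = cos x.
  by rewrite mulr_natl addrC cosD2pi cosN.
apply/seteqP; split => x /=; rewrite !in_itv /=.
  move=> [/andP[x0 x2] H].
  have [xpi|xpi] := leP x pi.
    by rewrite cos_le// in H; lra.
  by rewrite -cos_sym cos_le in H; lra.
move=> /andP[ax xa]; split; first lra.
have [xpi|xpi] := leP x pi; first by rewrite cos_le//; lra.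
by rewrite -cos_sym cos_le; lra.
Qed.

Lemma measure_sublevel_2cos (R : realType) (c : R) :
  2 * (2 * pi)^-1 * fine (@lebesgue_measure R
     (`[0, 2 * pi] `&` [set x | 2 * cos x <= c])) - 1 = vkls_slope c.
Proof.
have pi0 := pi_gt0 R.
have pin0 : pi != 0 :> R by rewrite gt_eqF.
have [cN2|cN2] := leP (-2) c; last first.
  rewrite (_ : _ `&` _ = set0).
    by rewrite measure0 /= /vkls_slope arc_leN2; [move: (pi : R) pin0 => p p0; field|lra].
  by apply/seteqP; split => x //= [_]; have := cos_geN1 x; lra.
rewrite sublevel_2cos// lebesgue_measure_itv /= lte_fin.
have /andP[a1 a2] := arc_itv c.
rewrite /vkls_slope; case: ifPn => [_|].
  by rewrite -EFinB /=; move: (pi : R) pin0 (arc c) => p p0 x; field.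
(* The interval degenerates to the point [pi], and both sides equal -1. *)
rewrite -leNgt => H; have -> : arc c = - (pi / 2) by lra.
by rewrite /=; move: (pi : R) pin0 => p p0; field.
Qed.

(** * Behaviour at infinity, existence and uniqueness *)

Lemma vkls_cvg_abs (R : realType) (F : set_system R) : Filter F ->
  (\forall c \near F, 2 <= `|c|) -> vkls c - `|c| @[c --> F] --> (0 : R).
Proof.
move=> FF F2; apply/cvgrPdist_lt => e e0; near=> c.
by rewrite vkls_out ?subrr ?normr0//; near: c.
Unshelve. all: by end_near. Qed.

Lemma vkls_cvg_pinfty (R : realType) :
  vkls c - `|c| @[c --> +oo] --> (0 : R).
Proof.
apply: vkls_cvg_abs; near=> c; rewrite ler_normr; apply/orP; left.
by near: c; exact: nbhs_pinfty_ge.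
Unshelve. all: by end_near. Qed.

Lemma vkls_is_profile (R : realType) :
  is_convex_action_profile (fun x : R => 2 * cos x) (@vkls R).
Proof.
have D (c : R) : is_derive c 1 (@vkls R) (vkls_slope c).
  apply: is_derive_subgradient; first exact: vkls_subgradient.
  exact: vkls_slope_continuous.
split.
- exact: subgradient_convex (@vkls_subgradient R).
- apply: aeW => c; split; first exact: (@ex_derive _ _ _ _ _ _ _ (D c)).
  rewrite derive1E (@derive_val _ _ _ _ _ _ _ (D c)) -measure_sublevel_2cos.
  by rewrite addrC subrK !mulrA mulVf// mul1r.
- rewrite mean_value_2cos; under eq_fun do rewrite subr0.
  exact: vkls_cvg_pinfty.
- rewrite mean_value_2cos; under eq_fun do rewrite subr0.
  apply: vkls_cvg_abs; near=> c; rewrite ler_normr; apply/orP; right.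
  by rewrite lerNr; near: c; exact: nbhs_ninfty_le.
Unshelve. all: by end_near. Qed.

Lemma profile_2cos_unique (R : realType) (f : R -> R) :
  is_convex_action_profile (fun x : R => 2 * cos x) f -> f = @vkls R.
Proof.
move=> [fc fae fpy _].
have fk : subgradient_field f (@vkls_slope R).
  apply: (subgradient_dense fc (@vkls_slope_continuous R)) => [a b|x y].
    exact: ae_dense fae.
  (* Where [f] is differentiable and satisfies the defining equation, its derivative is
     [vkls_slope]. *)
  move=> [df E]; rewrite -measure_sublevel_2cos -mulrA -E.
  rewrite mulrA mulfV// mul1r addrAC subrr add0r.
  exact: convex_derivable_subgradient.
have D (c : R) : is_derive c 1 (f - @vkls R) 0.
  have Df := is_derive_subgradient c fk (@vkls_slope_continuous R).
  have Dv := is_derive_subgradient c (@vkls_subgradient R)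
    (@vkls_slope_continuous R).
  by rewrite -(subrr (vkls_slope c)); exact: is_deriveB.
apply/funext => x; apply/subr0_eq.
have fx c : f c - vkls c = f x - vkls x := is_derive_0_is_cst c x D.
(* The constant difference is identified by its limit: both functions are asymptotic to [|c|], the
   mean value being 0. *)
have lim0 : f c - vkls c @[c --> +oo] --> (0 : R).
  rewrite mean_value_2cos in fpy.
  have -> : (fun c => f c - vkls c) =
      (fun c => f c - `|c - 0|) - (fun c => vkls c - `|c|).
    by apply/funext => c; rewrite !fctE subr0 opprB addrA subrK.
  by have := cvgB fpy (@vkls_cvg_pinfty R); rewrite subrr; apply.
rewrite (_ : (fun c => f c - vkls c) = fun=> f x - vkls x) in lim0;
  last exact/funext.
exact: cvg_unique (cvg_cst _) lim0.
Qed.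

Theorem proposition7p2p1 (R : realType) (f : R -> R) :
  is_convex_action_profile (fun x : R => 2 * cos x) f <->
  (forall c : R,
     (`|c| <= 2 ->
        f c = 2 / pi * (c * asin (c / 2) + Num.sqrt (4 - c ^+ 2))) /\
     (2 <= `|c| -> f c = `|c|)).
Proof.
split=> [/profile_2cos_unique -> c|H].
  by split; [exact: vkls_mid|exact: vkls_out].
rewrite (_ : f = @vkls R); first exact: vkls_is_profile.
apply/funext => c; have [c2|/ltW c2] := leP `|c| 2.
  by rewrite vkls_mid// (H c).1.
by rewrite vkls_out// (H c).2.
Qed.
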